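(* Let $n\geq 1$ and let $X_{1},X_{2},\ldots,X_{n}$ be independent real-valued random variables, and let $S_k=\sum_{i=1}^k X_i$ for $1\leq k\leq n$. Then for any real numbers $a_{1},a_{2},\ldots,a_{n}$ and any $t>0$, \[ \mathbb{P}\Big(\max_{1\leq k\leq n}\big||S_{k}|-a_{k}\big|>11t\Big)\leq 30\max_{1\leq k\leq n}\mathbb{P}\big(\big||S_{k}|-a_{k}\big|>t\big). \]
   Context: The random variables are defined on a common probability space with probability measure $\mathbb{P}$. No identical distribution, symmetry or integrability is assumed. *)

(* Defs.v *)
From HB Require Import structures.
From mathcomp Require Export all_boot all_order all_algebra.
From mathcomp Require Export all_classical all_reals all_analysis.

Set Implicit Arguments.
Unset Strict Implicit.
Unset Printing Implicit Defensive.

Import Order.TTheory GRing.Theory Num.Theory.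

Local Open Scope classical_set_scope.
Local Open Scope ring_scope.

(* Mutual independence: the product rule for every subfamily J and every
   choice of Borel sets. *)
Definition mutually_independent (d : measure_display) (T : measurableType d)
    (R : realType) (P : probability T R) (I : finType)
    (X : I -> {RV P >-> R}) : Prop :=
  forall (J : {set I}) (B : I -> set R),
    (forall i, i \in J -> measurable (B i)) ->
    P (\bigcap_(i in [set` J]) (X i @^-1` B i)) =
    (\prod_(i in J) P (X i @^-1` B i))%E.

(* Indices start at 0: partial_sum X k is the sum of the first k + 1
   variables. *)
Definition partial_sum (d : measure_display) (T : measurableType d)
    (R : realType) (P : probability T R) (n : nat)
    (X : 'I_n -> {RV P >-> R}) (k : 'I_n) (w : T) : R :=
  \sum_(i < n | (i <= k)%N) X i w.

(* Main.v *)
Require Import Defs.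
From HB Require Import structures.
From mathcomp Require Import ring lra.
From mathcomp Require Import measurable_realfun.
Set Implicit Arguments.
Unset Strict Implicit.
Unset Printing Implicit Defensive.
Import Order.TTheory GRing.Theory Num.Theory.
Local Open Scope classical_set_scope.
Local Open Scope ring_scope.

(** Write [p] for the right-hand maximum and assume [p < 1/30]. Call [x] a bad
start at time [j] if [||x| - a_j| > 11 t] and yet [x + (S_n - S_j)] is
within [t] of [{a_n, - a_n}] with probability more than [14/15]. Averaging over
[S_j] gives some [s] with [||s| - a_j| <= t] for which [s + (S_n - S_j)] is
also near [{a_n, - a_n}]. Since [|x - s| > 10 t], this forces [S_n - S_j] to
concentrate at one point, so that for some [b] in [{a_n, - a_n}] the sum [S_n]
concentrates near [b] while [x + (S_n - S_j)] concentrates near [- b]; the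
sign [b] does not depend on [j] or [x]. Let [m] be the last time that has a bad
start [y]. A bad start [x] at time [j <= m] is sent to near [y] at time [m],
because both continue to [- b] at time [n], and [||y| - a_m| > 11 t]. Hence,
from whatever value the walk takes when it first exceeds [11 t], it exceeds [t]
at time [n] or at time [m] with probability at least [1/15]. Summing over the
first exceedance time gives the bound [15 (p + p)]. *)

(** * Independence of the sigma-algebras generated by disjoint blocks of variables *)

(** The pi-system that generates the sigma-algebra of the variables [X i] with [i] in [J]. *)
Definition cylinders (T : Type) (R : realType) (I : finType)
    (X : I -> T -> R) (J : {set I}) : set (set T) :=
  [set A | exists2 B : I -> set R, (forall i, measurable (B i)) &
     A = \bigcap_(i in [set` J]) (X i @^-1` B i)].

Lemma cylinders_setI (T : Type) (R : realType) (I : finType)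
    (X : I -> T -> R) (J : {set I}) : setI_closed (cylinders X J).
Proof.
move=> _ _ [B mB ->] [C mC ->]; exists (fun i => B i `&` C i).
  by move=> i; exact: measurableI.
by rewrite -bigcapI; apply: eq_bigcapr => i _; rewrite preimage_setI.
Qed.

Lemma cylinders_setT (T : Type) (R : realType) (I : finType)
    (X : I -> T -> R) (J : {set I}) : cylinders X J setT.
Proof.
exists (fun=> setT) => //.
by apply/seteqP; split => // w _ i _.
Qed.

Lemma cylinders_preimage (T : Type) (R : realType) (I : finType)
    (X : I -> T -> R) (J : {set I}) (i : I) (B : set R) :
  i \in J -> measurable B -> cylinders X J (X i @^-1` B).
Proof.
move=> iJ mB; exists (fun k => if k == i then B else setT).
  by move=> k; case: ifP.
apply/seteqP; split => [w Bw k _ | w /(_ i iJ)] /=; last by rewrite eqxx.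
by case: eqP => // ->.
Qed.

Lemma measurable_cylinders (d : measure_display) (T : measurableType d)
    (R : realType) (P : probability T R) (I : finType) (X : I -> {RV P >-> R})
    (J : {set I}) : cylinders X J `<=` measurable.
Proof.
move=> _ [B mB ->]; apply: fin_bigcap_measurable => // i _.
exact: measurable_funPTI.
Qed.

Lemma sub_sigma_cylinders (d : measure_display) (T : measurableType d)
    (R : realType) (P : probability T R) (I : finType)
    (X : I -> {RV P >-> R}) (J : {set I}) (A : set T) :
  <<s cylinders X J >> A -> measurable A.
Proof.
apply: smallest_sub; first exact: sigma_algebra_measurable.
exact: measurable_cylinders.
Qed.

(** As [J] and [K] are disjoint, the two families of Borel sets glue into one family [C], and the
    product over the union splits. *)
Lemma indep_cylinders (d : measure_display) (T : measurableType d)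
    (R : realType) (P : probability T R) (I : finType) (X : I -> {RV P >-> R})
    (hX : mutually_independent X) (J K : {set I}) (A B : set T) :
  {in J, forall i, i \notin K} -> cylinders X J A -> cylinders X K B ->
  P (A `&` B) = (P A * P B)%E.
Proof.
move=> JK [A' mA ->] [B' mB ->].
pose C i := if i \in J then A' i else B' i.
have CJ i : i \in J -> C i = A' i by rewrite /C => ->.
have CK i : i \in K -> C i = B' i.
  by rewrite /C => iK; case: ifP => // /JK; rewrite iK.
have mC i : measurable (C i) by rewrite /C; case: ifP.
have -> : \bigcap_(i in [set` J]) (X i @^-1` A' i) =
          \bigcap_(i in [set` J]) (X i @^-1` C i).
  by apply: eq_bigcapr => i iJ; rewrite CJ.
have -> : \bigcap_(i in [set` K]) (X i @^-1` B' i) =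
          \bigcap_(i in [set` K]) (X i @^-1` C i).
  by apply: eq_bigcapr => i iJ; rewrite CK.
rewrite -bigcap_setU.
have -> : [set` J] `|` [set` K] = [set` J :|: K].
  by apply/seteqP; split => i /=; rewrite inE => /orP.
rewrite !hX // -bigU /=; first by apply: eq_bigl => i; rewrite !inE.
by apply/pred0P => i /=; apply/negP => /andP[/JK/negP].
Qed.

(** Both sides are finite measures in [A] that agree on the pi-system [G], hence on the
    sigma-algebra it generates. *)
Lemma indep_sigma (d : measure_display) (T : measurableType d) (R : realType)
    (P : probability T R) (G : set (set T)) (F : set T) :
  G `<=` measurable -> setI_closed G -> G setT -> measurable F ->
  (forall A, G A -> P (A `&` F) = (P A * P F)%E) ->
  forall A, <<s G >> A -> P (A `&` F) = (P A * P F)%E.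
Proof.
move=> mG GI GT mF GF A GA.
have PF0 : 0 <= fine (P F) by exact: fine_ge0.
have PFE : P F = (fine (P F))%:E by rewrite fineK // fin_num_measure.
pose m2 := mscale (NngNum PF0) P.
have m2E B : m2 B = (P B * P F)%E by rewrite /m2 /mscale /= -PFE muleC.
rewrite -m2E.
apply: (g_sigma_algebra_measure_unique G mG (fun=> setT)
  _ _ (mrestr P mF)) => //.
- by rewrite bigcup_const.
- by move=> B GB; rewrite [RHS]m2E -GF.
- by move=> _; rewrite /= /mrestr /= setTI ltey_eq fin_num_measure.
Qed.

(** [indep_sigma] is applied twice: to extend in [A] with [B] fixed, then to extend in [B] with [A]
    a cylinder. *)
Lemma indep_blocks (d : measure_display) (T : measurableType d) (R : realType)
    (P : probability T R) (I : finType) (X : I -> {RV P >-> R})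
    (hX : mutually_independent X) (J K : {set I}) (A B : set T) :
  {in J, forall i, i \notin K} ->
  <<s cylinders X J >> A -> <<s cylinders X K >> B ->
  P (A `&` B) = (P A * P B)%E.
Proof.
move=> JK sA sB.
move: A sA; apply: indep_sigma => //.
- exact: measurable_cylinders.
- exact: cylinders_setI.
- exact: cylinders_setT.
- exact: sub_sigma_cylinders sB.
move=> A cA; rewrite setIC muleC; move: B sB; apply: indep_sigma.
- exact: measurable_cylinders.
- exact: cylinders_setI.
- exact: cylinders_setT.
- exact: measurable_cylinders cA.
by move=> B cB; rewrite setIC muleC; exact: indep_cylinders cA cB.
Qed.

(** The domain carries the coarser sigma-algebra, so this says that events about the sum depend only
    on the variables in [J]. *)
Lemma measurable_cylinders_sum (T : pointedType) (R : realType) (I : finType)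
    (X : I -> T -> R) (J : {set I}) (Q : pred I) :
  (forall i, Q i -> i \in J) ->
  measurable_fun [set: g_sigma_algebraType (cylinders X J)]
    (fun w : g_sigma_algebraType (cylinders X J) => \sum_(i | Q i) X i w).
Proof.
move=> QJ.
under eq_fun do rewrite big_mkcond /=.
apply: measurable_sum => i; case: (boolP (Q i)) => [/QJ iJ|_];
  last exact: measurable_cst.
move=> _ B mB; rewrite setTI; apply: sub_sigma_algebra.
exact: cylinders_preimage.
Qed.

(** * Laws restricted to an event, and Fubini for independent pairs *)

(** The law of [U] under [P] restricted to [E], not normalized: its mass is [P E]. The measurability
    proofs are arguments so that the measure structure can be inferred. *)
Definition law_on (d d' : measure_display) (T : measurableType d)
    (T' : measurableType d') (R : realType) (P : probability T R) (E : set T)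
    (U : T -> T') & measurable E & measurable_fun setT U : set T' -> \bar R :=
  fun A => P (E `&` U @^-1` A).

Section law_on_measure.
Context (d d' : measure_display) (T : measurableType d)
  (T' : measurableType d') (R : realType) (P : probability T R) (E : set T)
  (U : T -> T') (mE : measurable E) (mU : measurable_fun setT U).

Local Notation mu := (law_on P mE mU).

Let mpre A : measurable A -> measurable (E `&` U @^-1` A).
Proof.
by move=> mA; apply: measurableI => //; rewrite -[_ @^-1` _]setTI; exact: mU.
Qed.

Let mu0 : mu set0 = 0%E.
Proof. by rewrite /law_on preimage_set0 setI0 measure0. Qed.

Let mu_ge0 A : (0 <= mu A)%E.
Proof. exact: measure_ge0. Qed.

Let mu_sigma_additive : semi_sigma_additive mu.
Proof.
move=> F mF tF mUF; rewrite /law_on preimage_bigcup setI_bigcupr.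
apply: measure_semi_sigma_additive.
- by move=> n; exact: mpre.
- apply/trivIsetP => /= i j _ _ ij; rewrite setIACA -preimage_setI.
  by move/trivIsetP : tF => /(_ _ _ _ _ ij) ->//; rewrite preimage_set0 setI0.
- by rewrite -setI_bigcupr -preimage_bigcup; exact: mpre.
Qed.

HB.instance Definition _ :=
  isMeasure.Build _ _ _ mu mu0 mu_ge0 mu_sigma_additive.

Let mu_fin : fin_num_fun mu.
Proof. by move=> A mA; apply: fin_num_measure; exact: mpre. Qed.

HB.instance Definition _ := Measure_isFinite.Build _ _ _ mu mu_fin.

End law_on_measure.

Section indep_fubini.
Context (d : measure_display) (T : measurableType d) (R : realType)
    (P : probability T R) (E : set T) (mE : measurable E)
    (U V : T -> R) (mU : measurable_fun setT U) (mV : measurable_fun setT V)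
    (C : set (R * R)) (mC : measurable C).

Let phiE : (fun x => P [set w | C (x, V w)]) =
  law_on P measurableT mV \o xsection C.
Proof.
apply/funext => x /=; rewrite /law_on setTI; congr (P _).
by apply/seteqP; split => y /=; rewrite /xsection /= inE.
Qed.

Lemma measurable_section_prob :
  measurable_fun setT (fun x => P [set w | C (x, V w)]).
Proof. by rewrite phiE; exact: measurable_fun_xsection. Qed.

(** The hypothesis identifies the law of [(U, V)] on [E] with a product measure on rectangles, so it
    is that product measure, and [C] is measured by its sections. *)
Lemma indep_fubini :
  (forall A B : set R, measurable A -> measurable B ->
    P (E `&` U @^-1` A `&` V @^-1` B)
    = (P (E `&` U @^-1` A) * P (V @^-1` B))%E) ->
  P (E `&` [set w | C (U w, V w)]) =
  (\int[law_on P mE mU]_x P [set w | C (x, V w)])%E.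
Proof.
move=> UV.
have mUV : measurable_fun setT (fun w => (U w, V w)).
  exact: measurable_fun_pair.
transitivity (law_on P mE mUV C) => //.
rewrite phiE; apply/esym/product_measure_unique => // A B mA mB.
rewrite /= /law_on setTI -UV // -setIA; congr (P (_ `&` _)).
Qed.

End indep_fubini.

(** * Real-valued probabilities, union bounds and conditioning *)

(** Taking values in [R] makes the estimates accessible to linear arithmetic. *)
Definition prob (d : measure_display) (T : measurableType d) (R : realType)
  (P : probability T R) (A : set T) : R := fine (P A).

Lemma probE (d : measure_display) (T : measurableType d) (R : realType)
    (P : probability T R) (A : set T) :
  measurable A -> (prob P A)%:E = P A.
Proof. by move=> mA; rewrite /prob fineK // fin_num_measure. Qed.

Lemma prob_ge0 (d : measure_display) (T : measurableType d) (R : realType)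
    (P : probability T R) (A : set T) : 0 <= prob P A.
Proof. exact: fine_ge0. Qed.

Lemma prob_setT (d : measure_display) (T : measurableType d) (R : realType)
    (P : probability T R) : prob P setT = 1.
Proof. by rewrite /prob probability_setT. Qed.

Lemma prob_le (d : measure_display) (T : measurableType d) (R : realType)
    (P : probability T R) (A B : set T) :
  measurable A -> measurable B -> A `<=` B -> prob P A <= prob P B.
Proof.
by move=> mA mB AB; rewrite -lee_fin !probE // le_measure // inE.
Qed.

Lemma probU_le (d : measure_display) (T : measurableType d) (R : realType)
    (P : probability T R) (A B : set T) :
  measurable A -> measurable B -> prob P (A `|` B) <= prob P A + prob P B.
Proof.
move=> mA mB; rewrite -lee_fin EFinD !probE //; first exact: measureU2.
exact: measurableU.
Qed.

Lemma prob_cover2 (d : measure_display) (T : measurableType d) (R : realType)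
    (P : probability T R) (A B : set T) :
  measurable A -> measurable B -> setT `<=` A `|` B ->
  1 <= prob P A + prob P B.
Proof.
move=> mA mB AB; apply: le_trans (probU_le P mA mB).
by rewrite -(prob_setT P) prob_le //; exact: measurableU.
Qed.

Lemma prob_cover3 (d : measure_display) (T : measurableType d) (R : realType)
    (P : probability T R) (A B C : set T) :
  measurable A -> measurable B -> measurable C -> setT `<=` A `|` B `|` C ->
  1 <= prob P A + prob P B + prob P C.
Proof.
move=> mA mB mC ABC; apply: (le_trans (prob_cover2 P _ mC ABC)).
  exact: measurableU.
by rewrite lerD2r probU_le.
Qed.

Lemma measurable_pair_event (d : measure_display) (T : measurableType d)
    (R : realType) (U V : T -> R) (C : set (R * R)) :
  measurable_fun setT U -> measurable_fun setT V -> measurable C ->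
  measurable [set w | C (U w, V w)].
Proof.
move=> mU mV mC; rewrite -[X in measurable X]setTI.
exact: (measurable_fun_pair mU mV).
Qed.

(** The pointwise bound is integrated against the law of [U] on [E], which lives on [A] and has mass
    [P E]. Fubini is applied to each of [V1] and [V2] separately. *)
Lemma indep_lower_bound (d : measure_display) (T : measurableType d)
    (R : realType) (P : probability T R) (E : set T) (U V1 V2 : T -> R)
    (A : set R) (C1 C2 : set (R * R)) (c : R) :
  measurable E -> measurable_fun setT U ->
  measurable_fun setT V1 -> measurable_fun setT V2 ->
  measurable A -> measurable C1 -> measurable C2 ->
  (forall B1 B2 : set R, measurable B1 -> measurable B2 ->
    P (E `&` U @^-1` B1 `&` V1 @^-1` B2)
    = (P (E `&` U @^-1` B1) * P (V1 @^-1` B2))%E) ->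
  (forall B1 B2 : set R, measurable B1 -> measurable B2 ->
    P (E `&` U @^-1` B1 `&` V2 @^-1` B2)
    = (P (E `&` U @^-1` B1) * P (V2 @^-1` B2))%E) ->
  E `<=` U @^-1` A -> 0 <= c ->
  (forall x, A x ->
    c <= prob P [set w | C1 (x, V1 w)] + prob P [set w | C2 (x, V2 w)]) ->
  c * prob P E <= prob P (E `&` [set w | C1 (U w, V1 w)]) +
                  prob P (E `&` [set w | C2 (U w, V2 w)]).
Proof.
move=> mE mU mV1 mV2 mA mC1 mC2 i1 i2 EA c0 cC.
have m1 := measurable_section_prob P mV1 mC1.
have m2 := measurable_section_prob P mV2 mC2.
rewrite -lee_fin EFinM EFinD !probE //; first last.
- by apply: measurableI => //; exact: measurable_pair_event.
- by apply: measurableI => //; exact: measurable_pair_event.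
rewrite (indep_fubini mE mU mV1) // (indep_fubini mE mU mV2) //.
rewrite -ge0_integralD //; try by move=> x _; exact: measure_ge0.
have -> : P E = law_on P mE mU A.
  by rewrite /law_on; congr (P _); apply/esym/setIidPl.
rewrite -integral_cst //.
apply: (@le_trans _ _ (\int[law_on P mE mU]_(x in A)
   (P [set w | C1 (x, V1 w)] + P [set w | C2 (x, V2 w)]))%E); last first.
  apply: ge0_subset_integral => //; first exact: emeasurable_funD.
  by move=> x _; exact: adde_ge0.
apply: ge0_le_integral => //.
  by apply: emeasurable_funD; exact: measurable_funTS.
move=> x Ax; have := cC x Ax; rewrite -lee_fin EFinD !probE //.
- exact: (@measurable_pair_event _ _ _ (cst x)).
- exact: (@measurable_pair_event _ _ _ (cst x)).
Qed.

(** * Measurability of far events, and distance estimates *)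

Lemma measurable_gt (d : measure_display) (T : measurableType d)
    (R : realType) (U : T -> R) (t : R) :
  measurable_fun setT U -> measurable [set w | t < U w].
Proof.
move=> mU; have -> : [set w | t < U w] = setT `&` U @^-1` `]t, +oo[%classic.
  by apply/seteqP; split => w /=; rewrite in_itv /= andbT => // -[].
exact: mU.
Qed.

Lemma measurable_far (d : measure_display) (T : measurableType d)
    (R : realType) (U : T -> R) (r t : R) :
  measurable_fun setT U -> measurable [set w | t < `| `|U w| - r|].
Proof.
move=> mU; apply: measurable_gt; apply: measurableT_comp => //.
by apply: measurable_funB => //; exact: measurableT_comp.
Qed.

Lemma near_abs (R : realType) (y r t : R) :
  `| `|y| - r| <= t -> `|y - r| <= t \/ `|y + r| <= t.
Proof.
by case: (ger0P y) => _ h; [left | right]; rewrite // -normrN opprD.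
Qed.

Lemma far_dist (R : realType) (s x r t : R) :
  `| `|s| - r| <= t -> 11 * t < `| `|x| - r| -> 10 * t < `|x - s|.
Proof.
have := ler_dist_dist x s; rewrite !ler_norml => /andP[h1 h2] /andP[h3 h4].
case: (ger0P (`|x| - r)); lra.
Qed.

Lemma near_sign (R : realType) (y b q t : R) : b = q \/ b = - q ->
  `| `|y| - q| <= t -> `|y - b| <= t \/ `|y + b| <= t.
Proof.
move=> [] -> /near_abs; rewrite ?opprK; first by [].
by case; [right | left].
Qed.

(** The triangle inequality gives [2 * t]; the weaker bound is the one that contradicts
    [far_dist]. *)
Lemma near_dist (R : realType) (x u v b t : R) :
  `|x + v + b| <= t -> `|u + v + b| <= t -> `|x - u| <= 10 * t.
Proof.
move=> h1 h2; have h0 := le_trans (normr_ge0 _) h1.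
have -> : x - u = (x + v + b) - (u + v + b) by ring.
apply: le_trans (ler_normB _ _) _; lra.
Qed.

(** * Concentration forced by a bad start *)

(** If every [s] near [r] or [- r] failed, averaging over [U] would give [(1 - p) / 15 <= p], which
    is false for [p < 1 / 30]. *)
Lemma exists_typical (d : measure_display) (T : measurableType d)
    (R : realType) (P : probability T R) (U V : T -> R) (r q t p : R) :
  measurable_fun setT U -> measurable_fun setT V ->
  (forall B1 B2 : set R, measurable B1 -> measurable B2 ->
    P (U @^-1` B1 `&` V @^-1` B2) = (P (U @^-1` B1) * P (V @^-1` B2))%E) ->
  p < 1 / 30 ->
  prob P [set w | t < `| `|U w| - r|] <= p ->
  prob P [set w | t < `| `|U w + V w| - q|] <= p ->
  exists2 s, `| `|s| - r| <= t &
    prob P [set w | t < `| `|s + V w| - q|] < 1 / 15.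
Proof.
move=> mU mV UV p30 PU PUV; apply: contrapT => none.
pose A := ~` [set x : R | t < `| `|x| - r|].
have mA : measurable A by apply: measurableC; exact: measurable_far.
have mE : measurable (U @^-1` A).
  by rewrite -[X in measurable X]setTI; exact: mU.
pose C := [set z : R * R | t < `| `|z.1 + z.2| - q|].
have mC : measurable C.
  by apply: measurable_far; apply: measurable_funD; [exact: measurable_fst
    | exact: measurable_snd].
have mUV : measurable [set w | C (U w, V w)] by exact: measurable_pair_event.
have UV' B1 B2 : measurable B1 -> measurable B2 ->
    P (U @^-1` A `&` U @^-1` B1 `&` V @^-1` B2)
    = (P (U @^-1` A `&` U @^-1` B1) * P (V @^-1` B2))%E.
  by move=> m1 m2; rewrite -preimage_setI UV //; exact: measurableI.
(* The two events are both taken to be [C], hence [2 / 15] for twice the assumed [1 / 15]. *)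
have := @indep_lower_bound _ _ _ P (U @^-1` A) U V V A C C (2 / 15)
  mE mU mV mV mA mC mC UV' UV' (@subset_refl _ _).
have cA x : A x ->
    2 / 15 <= prob P [set w | C (x, V w)] + prob P [set w | C (x, V w)].
  move=> /negP; rewrite -leNgt => xr.
  suff : 1 / 15 <= prob P [set w | C (x, V w)] by lra.
  by rewrite leNgt; apply/negP => h; apply: none; exists x.
move=> /(_ _ cA) lb.
have {}lb := lb ltac:(lra).
have h1 : prob P (U @^-1` A `&` [set w | C (U w, V w)]) <= p.
  by apply: le_trans PUV; apply: prob_le => //; exact: measurableI.
have h2 : 1 <= prob P (U @^-1` A) + prob P [set w | t < `| `|U w| - r|].
  apply: prob_cover2 => //; first exact: measurable_far.
  by move=> w _; rewrite /A setUC; exact: lem.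
lra.
Qed.

(** When both continuations are near [- b], subtracting them puts [x + V1] within [2 * t] of [y],
    which is too far from [r] in absolute value. The exceptional events have total probability below
    [4 / 15]. *)
Lemma prob_far_combine (d : measure_display) (T : measurableType d)
    (R : realType) (P : probability T R) (V1 V2 : T -> R) (x y b r t : R) :
  measurable_fun setT V1 -> measurable_fun setT V2 ->
  11 * t < `| `|y| - r| ->
  prob P [set w | t < `|x + (V1 w + V2 w) + b|] < 2 / 15 ->
  prob P [set w | t < `|y + V2 w + b|] < 2 / 15 ->
  2 / 15 <= prob P [set w | t < `| `|x + V1 w| - r|].
Proof.
move=> m1 m2 yr Px Py.
set Bx := [set w | _] in Px; set By := [set w | _] in Py.
have mBx : measurable Bx.
  apply: measurable_gt; apply: measurableT_comp => //.
  apply: measurable_funD => //; apply: measurable_funD => //.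
  exact: measurable_funD.
have mBy : measurable By.
  apply: measurable_gt; apply: measurableT_comp => //.
  by apply: measurable_funD => //; exact: measurable_funD.
have mF : measurable [set w | t < `| `|x + V1 w| - r|].
  by apply: measurable_far; exact: measurable_funD.
have := prob_cover3 P mF mBx mBy.
suff h : setT `<=` [set w | t < `| `|x + V1 w| - r|] `|` Bx `|` By.
  move=> /(_ h); lra.
move=> w _; apply: contrapT => /not_orP[/not_orP[/negP h1 /negP h2] /negP].
rewrite -leNgt; move: h1 h2; rewrite -!leNgt => h1 h2 h3.
have := far_dist h1 yr; rewrite ltNge distrC => /negP; apply.
by apply: near_dist h3; rewrite -(addrA x); exact: h2.
Qed.

Lemma reflected_center (d : measure_display) (T : measurableType d)
    (R : realType) (P : probability T R) (U V : T -> R) (s x r q t p : R) :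
  measurable_fun setT U -> measurable_fun setT V ->
  p < 1 / 30 ->
  prob P [set w | t < `| `|U w| - r|] <= p ->
  prob P [set w | t < `| `|U w + V w| - q|] <= p ->
  `| `|s| - r| <= t -> 11 * t < `| `|x| - r| ->
  prob P [set w | t < `| `|s + V w| - q|] < 1 / 15 ->
  prob P [set w | t < `| `|x + V w| - q|] < 1 / 15 ->
  exists b, [/\ b = q \/ b = - q, 4 * t < `|b|,
    prob P [set w | t < `|x + V w + b|] < 2 / 15 &
    prob P [set w | t < `|U w + V w - b|] < 1 / 2].
Proof.
move=> mU mV p30 PU PUV sr xr Ps Px.
have xs := far_dist sr xr.
set Bs := [set w | _ < `| `|s + _| - _|] in Ps.
set Bx := [set w | _ < `| `|x + _| - _|] in Px.
set BU := [set w | _ < `| `|U _| - _|] in PU.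
set BUV := [set w | _ < `| `|U _ + _| - _|] in PUV.
have mBs : measurable Bs by apply: measurable_far; exact: measurable_funD.
have mBx : measurable Bx by apply: measurable_far; exact: measurable_funD.
have mBU : measurable BU by exact: measurable_far.
have mBUV : measurable BUV by apply: measurable_far; exact: measurable_funD.
(* A common good point exists because [1 / 15 + 1 / 15 < 1]; it fixes the sign of [b]. *)
have {sr} [w0 [w0s w0x]] : exists w, ~ Bs w /\ ~ Bx w.
  apply: contrapT => none.
  have : 1 <= prob P Bs + prob P Bx.
    apply: prob_cover2 => // w _; apply: contrapT => /not_orP nB.
    by apply: none; exists w.
  lra.
(* As [s] and [x] are far apart, [s + V] and [x + V] are near opposite ones of
   [q] and [- q]; which one is near which is determined by [x - s]. *)
have cen v : `| `|s + v| - q| <= t -> `| `|x + v| - q| <= t ->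
    (`|s + v - q| <= t /\ `|x + v + q| <= t) \/
    (`|s + v + q| <= t /\ `|x + v - q| <= t).
  move=> /near_abs[] h1 /near_abs[] h2; [| by left | by right |].
    by move: xs; rewrite ltNge (near_dist h2 h1).
  by move: xs; rewrite ltNge (near_dist h2 h1).
have [b bq [w0s' w0x']] : exists2 b, b = q \/ b = - q &
    `|s + V w0 - b| <= t /\ `|x + V w0 + b| <= t.
  have /cen : `| `|s + V w0| - q| <= t by rewrite leNgt; exact/negP.
  have h : `| `|x + V w0| - q| <= t by rewrite leNgt; exact/negP.
  move=> /(_ h)[[h1 h2]|[h1 h2]]; first by exists q => //; left.
  by exists (- q); [right | rewrite opprK].
(* With the opposite signs at [w], [x - s] would be within [2 * t] of [2 * b], while [w0] puts it
   within [2 * t] of [- 2 * b]; together these give [|x - s| <= 2 * t]. *)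
have bc w : ~ Bs w -> ~ Bx w -> `|x + V w + b| <= t.
  move=> /negP; rewrite -leNgt => hs /negP; rewrite -leNgt => hx.
  have [h1|//] := near_sign bq hx.
  have [h2|h2] := near_sign bq hs.
    by move: xs; rewrite ltNge (near_dist h1 h2).
  move: xs h1 h2 w0s' w0x'; rewrite !ler_norml.
  move=> + /andP[h1 h2] /andP[h3 h4] /andP[h5 h6] /andP[h7 h8].
  case: (ger0P (x - s)); lra.
(* Here [x - s] is within [2 * t] of [- 2 * b] and exceeds [10 * t] in absolute value. *)
have b4 : 4 * t < `|b|.
  move: xs w0s' w0x'; rewrite !ler_norml; move=> + /andP[h1 h2] /andP[h3 h4].
  by case: (ger0P (x - s)); case: (ger0P b); lra.
have mN : measurable [set w | t < `|x + V w + b|].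
  apply: measurable_gt; apply: measurableT_comp => //.
  by apply: measurable_funD => //; exact: measurable_funD.
have mF : measurable [set w | t < `|U w + V w - b|].
  apply: measurable_gt; apply: measurableT_comp => //.
  by apply: measurable_funB => //; exact: measurable_funD.
have PN : prob P [set w | t < `|x + V w + b|] <= prob P Bs + prob P Bx.
  apply: le_trans (probU_le P mBs mBx); apply: prob_le => //.
    exact: measurableU.
  move=> w /= h; apply: contrapT => /not_orP[/bc h1 /h1].
  by rewrite leNgt h.
exists b; split => //; first lra.
(* Off the three events, [U + V] near [- b] would put [U] within [2 * t] of [x], against [far_dist].
   The total is below [2 / 15 + 2 / 30 < 1 / 2]. *)
have : prob P [set w | t < `|U w + V w - b|] <=
    prob P [set w | t < `|x + V w + b|] + prob P BUV + prob P BU.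
  apply: le_trans; last first.
    apply: lerD; last exact: lexx.
    exact: (probU_le P mN mBUV).
  apply: le_trans (probU_le P _ mBU); last exact: measurableU.
  apply: prob_le => //; first by apply: measurableU => //; exact: measurableU.
  move=> w /= h; apply: contrapT => /not_orP[/not_orP[/negP h1 /negP h2]].
  move: h1 h2; rewrite -!leNgt => h1 h2 /negP; rewrite -leNgt => h3.
  have [//|h4] := near_sign bq h2; first by rewrite leNgt h.
  have := far_dist h3 xr; rewrite ltNge => /negP; apply.
  exact: near_dist h1 h4.
lra.
Qed.

(** * Partial sums, increments and independence from the past *)

Definition increment (d : measure_display) (T : measurableType d)
    (R : realType) (P : probability T R) (n : nat)
    (X : 'I_n -> {RV P >-> R}) (j k : 'I_n) (w : T) : R :=
  \sum_(i < n | (j < i <= k)%N) X i w.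

Definition past (n : nat) (j : 'I_n) : {set 'I_n} :=
  [set i : 'I_n | (i <= j)%N]%SET.

Lemma partial_sumD (d : measure_display) (T : measurableType d)
    (R : realType) (P : probability T R) (n : nat)
    (X : 'I_n -> {RV P >-> R}) (j k : 'I_n) (w : T) :
  (j <= k)%N -> partial_sum X k w = partial_sum X j w + increment X j k w.
Proof.
move=> jk; rewrite /partial_sum (bigID (fun i : 'I_n => (i <= j)%N)) /=.
congr (_ + _); apply: eq_bigl => i.
  by case: (leqP i j) => [ij|_]; rewrite ?andbF // (leq_trans ij jk).
by rewrite -ltnNge andbC.
Qed.

Lemma incrementD (d : measure_display) (T : measurableType d)
    (R : realType) (P : probability T R) (n : nat)
    (X : 'I_n -> {RV P >-> R}) (j m k : 'I_n) (w : T) :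
  (j <= m)%N -> (m <= k)%N ->
  increment X j k w = increment X j m w + increment X m k w.
Proof.
move=> jm mk; have := partial_sumD X w (leq_trans jm mk).
rewrite (partial_sumD X w mk) (partial_sumD X w jm) -addrA.
by move/addrI => ->.
Qed.

Lemma measurable_sumRV (d : measure_display) (T : measurableType d)
    (R : realType) (P : probability T R) (I : finType)
    (X : I -> {RV P >-> R}) (Q : pred I) :
  measurable_fun setT (fun w => \sum_(i | Q i) X i w).
Proof.
under eq_fun do rewrite big_mkcond /=.
by apply: measurable_sum => i; case: (Q i).
Qed.

Lemma indep_increment (d : measure_display) (T : measurableType d)
    (R : realType) (P : probability T R) (n : nat)
    (X : 'I_n -> {RV P >-> R}) (hX : mutually_independent X) (j k : 'I_n)
    (E : set T) (B1 B2 : set R) :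
  <<s cylinders X (past j) >> E -> measurable B1 -> measurable B2 ->
  P (E `&` partial_sum X j @^-1` B1 `&` increment X j k @^-1` B2) =
  (P (E `&` partial_sum X j @^-1` B1) * P (increment X j k @^-1` B2))%E.
Proof.
move=> sE m1 m2.
apply: (@indep_blocks _ _ _ _ _ X hX (past j) (~: past j)%SET).
- by move=> i; rewrite !inE => ->.
- pose TJ := g_sigma_algebraType (cylinders X (past j)).
  apply: (@measurableI _ TJ) => //.
  rewrite -[X in measurable X]setTI.
  apply: (@measurable_cylinders_sum T R _ X (past j)) => // i.
  by rewrite inE.
- rewrite -[X in _ X]setTI.
  apply: (@measurable_cylinders_sum T R _ X (~: past j)%SET) => // i.
  by rewrite !inE -ltnNge => /andP[].
Qed.

(** * Decomposition by the first exceedance time *)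

Lemma bigsetU_ordP (T : Type) (n : nat) (F : 'I_n -> set T) (w : T) :
  (\big[setU/set0]_(i < n) F i) w <-> exists i, F i w.
Proof.
elim: n F => [|n IH] F; first by rewrite big_ord0; split => // -[[]].
rewrite big_ord_recl; split => [[h|/IH[i h]]|[i]]; first by exists ord0.
  by exists (lift ord0 i).
case: (unliftP ord0 i) => [k ->|->] h; last by left.
by right; apply/IH; exists k.
Qed.

Definition first_exceed (T : Type) (R : realType) (n : nat) (Y : 'I_n -> T -> R)
    (u : R) (j : 'I_n) : set T :=
  [set w | u < Y j w] `&`
  \bigcap_(i in [set i : 'I_n | (i < j)%N]) ~` [set w | u < Y i w].

Lemma trivIset_first_exceed (T : Type) (R : realType) (n : nat)
    (Y : 'I_n -> T -> R) (u : R) : trivIset setT (first_exceed Y u).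
Proof.
apply/trivIsetP => i j _ _ ij; rewrite -subset0 => w.
move=> [[h1 h2] [h3 h4]].
have [ltij|ltji|/val_inj eij] := ltngtP i j.
- exact: h4 ltij h1.
- exact: h2 ltji h3.
- by rewrite eij eqxx in ij.
Qed.

Lemma first_exceedP (T : Type) (R : realType) (n : nat)
    (Y : 'I_n -> T -> R) (u : R) (w : T) :
  (exists j, first_exceed Y u j w) <-> exists j, u < Y j w.
Proof.
split => [[j [h _]]|[j h]]; first by exists j.
have [k hk kmin] := arg_minnP (P := fun i => u < Y i w)
  (fun i : 'I_n => i : nat) h.
exists k; split => // i ik /= hi.
by have := kmin i hi; rewrite leqNgt ik.
Qed.

Lemma sum_prob_disjoint_le (d : measure_display) (T : measurableType d)
    (R : realType) (P : probability T R) (n : nat) (F : 'I_n -> set T)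
    (B : set T) :
  (forall i, measurable (F i)) -> trivIset setT F -> measurable B ->
  \sum_(i < n) prob P (F i `&` B) <= prob P B.
Proof.
move=> mF tF mB.
have mFB i : measurable (F i `&` B) by exact: measurableI.
rewrite -lee_fin -sumEFin probE //.
under eq_bigr do rewrite probE //.
rewrite -measure_bigsetU_ord //; last exact: trivIset_setIr.
rewrite le_measure ?inE //; first exact: bigsetU_measurable.
by move=> w /bigsetU_ordP[i []].
Qed.

(** Only times up to [j] enter, so the lemma also applies over the sigma-algebra of the past of
    [j]. *)
Lemma measurable_first_exceed (d : measure_display) (T : measurableType d)
    (R : realType) (n : nat) (Y : 'I_n -> T -> R) (u : R) (j : 'I_n) :
  (forall i : 'I_n, (i <= j)%N -> measurable_fun setT (Y i)) ->
  measurable (first_exceed Y u j).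
Proof.
move=> mY; apply: measurableI; first exact/measurable_gt/mY.
apply: fin_bigcap_measurable => // i /= /ltnW ij.
exact/measurableC/measurable_gt/mY.
Qed.

(** * The last time with a bad start *)

(** One time [m] serves all [j] and [x]: a start that is not bad is still far at the final time, and
    a bad one is far at [m]. *)
Lemma far_start_dichotomy (d : measure_display) (T : measurableType d)
    (R : realType) (P : probability T R) (n : nat)
    (X : 'I_n.+1 -> {RV P >-> R}) (hX : mutually_independent X)
    (a : 'I_n.+1 -> R) (t p : R) :
  0 < t -> p < 1 / 30 ->
  (forall k, prob P [set w | t < `| `|partial_sum X k w| - a k|] <= p) ->
  exists m : 'I_n.+1, forall j x, 11 * t < `| `|x| - a j| ->
    1 / 15 <= prob P
      [set w | t < `| `|x + increment X j ord_max w| - a ord_max|] \/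
    (j <= m)%N /\
       1 / 15 <= prob P [set w | t < `| `|x + increment X j m w| - a m|].
Proof.
move=> t0 p30 Pp.
have mS k : measurable_fun setT (partial_sum X k) by exact: measurable_sumRV.
have mD j k : measurable_fun setT (increment X j k) by exact: measurable_sumRV.
have le_max (j : 'I_n.+1) : (j <= (ord_max : 'I_n.+1))%N by rewrite -ltnS.
pose bad j x := 11 * t < `| `|x| - a j| /\
  prob P [set w | t < `| `|x + increment X j ord_max w| - a ord_max|] < 1 / 15.
have center j x : bad j x -> exists b,
    [/\ b = a ord_max \/ b = - a ord_max, 4 * t < `|b|,
    prob P [set w | t < `|x + increment X j ord_max w + b|] < 2 / 15 &
    prob P [set w | t < `|partial_sum X ord_max w - b|] < 1 / 2].
  move=> [xj Px].
  have SE : partial_sum X ord_max =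
      fun w => partial_sum X j w + increment X j ord_max w.
    by apply/funext => w; exact: partial_sumD.
  have PS := Pp ord_max; rewrite SE in PS *.
  have [|s sj Ps] := @exists_typical _ _ _ P (partial_sum X j)
    (increment X j ord_max) (a j) (a ord_max) t p
    (mS j) (mD j ord_max) _ p30 (Pp j) PS.
    move=> B1 B2 m1 m2.
    have := @indep_increment _ _ _ _ _ X hX j ord_max setT B1 B2 _ m1 m2.
    rewrite !setTI; apply; apply: sub_sigma_algebra; exact: cylinders_setT.
  exact: (reflected_center (mS j) (mD j _) p30 (Pp j) PS sj xj Ps Px).
(* Distinct candidates are opposite. As [4 * t < |b|], the final sum cannot be near both, yet it is
   near each with probability above [1 / 2]. *)
have center_uniq b b' :
    b = a ord_max \/ b = - a ord_max -> b' = a ord_max \/ b' = - a ord_max ->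
    4 * t < `|b| ->
    prob P [set w | t < `|partial_sum X ord_max w - b|] < 1 / 2 ->
    prob P [set w | t < `|partial_sum X ord_max w - b'|] < 1 / 2 -> b = b'.
  move=> bq b'q b4 Pb Pb'.
  have mF c : measurable [set w | t < `|partial_sum X ord_max w - c|].
    apply: measurable_gt; apply: measurableT_comp => //.
    exact: measurable_funB.
  apply: contrapT => bb'.
  have : 1 <= prob P [set w | t < `|partial_sum X ord_max w - b|] +
              prob P [set w | t < `|partial_sum X ord_max w - b'|].
    apply: prob_cover2 => // w _; apply: contrapT.
    move=> /not_orP[/negP + /negP]; rewrite -!leNgt.
    have {bq b'q} -> : b' = - b by case: bq b'q bb' => -> [] ->; rewrite ?opprK.
    move: b4; rewrite !ler_norml => + /andP[h1 h2] /andP[h3 h4].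
    by case: (ger0P b); lra.
  lra.
pose J j := `[< exists x, bad j x >].
(* Without bad starts the first alternative always holds, and [m] is arbitrary. *)
have [j0 Jj0|noJ] := pickP J; last first.
  exists ord_max => j x xj; left; rewrite leNgt; apply/negP => Px.
  by have /asboolP := negbT (noJ j); apply; exists x.
have [m /asboolP[y ym] mmax] := @arg_maxnP _ _ J (fun i => i : nat) Jj0.
exists m => j x xj; rewrite leNgt.
have [Px|_] := boolP (_ < _); last by left.
have xbad : bad j x by [].
have jm : (j <= m)%N by apply: mmax; apply/asboolP; exists x.
right; split => //.
have [b [bq b4 Pxb Pb]] := center _ _ xbad.
have [b' [b'q _ Pyb Pb']] := center _ _ ym.
(* The centre is a property of the final sum alone, so the starts [x] and [y] share it. *)
move: (center_uniq _ _ bq b'q b4 Pb Pb') Pyb => <- Pyb.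
have DE : increment X j ord_max =
    fun w => increment X j m w + increment X m ord_max w.
  by apply/funext => w; exact: incrementD jm (le_max m).
rewrite DE in Pxb.
have := prob_far_combine (mD j m) (mD m ord_max) ym.1 Pxb Pyb.
lra.
Qed.

(** * From the first exceedance to the maximal inequality *)

(** [F] is determined by the variables up to [j], hence independent of later increments, and on [F]
    the value of the walk at [j] satisfies the premise of the pointwise bound. *)
Lemma first_exceed_bound (d : measure_display) (T : measurableType d)
    (R : realType) (P : probability T R) (n : nat)
    (X : 'I_n -> {RV P >-> R}) (hX : mutually_independent X)
    (a : 'I_n -> R) (t c u : R) (j k1 k2 : 'I_n) :
  0 <= c -> (j <= k1)%N -> (j <= k2)%N ->
  let far k := [set w | t < `| `|partial_sum X k w| - a k|] in
  let F := first_exceed (fun k w => `| `|partial_sum X k w| - a k|) u j in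
  (forall x, u < `| `|x| - a j| ->
    c <= prob P [set w | t < `| `|x + increment X j k1 w| - a k1|] +
         prob P [set w | t < `| `|x + increment X j k2 w| - a k2|]) ->
  c * prob P F <= prob P (F `&` far k1) + prob P (F `&` far k2).
Proof.
move=> c0 jk1 jk2 far F hc.
have mS k : measurable_fun setT (partial_sum X k) by exact: measurable_sumRV.
have mD k : measurable_fun setT (increment X j k) by exact: measurable_sumRV.
pose TJ := g_sigma_algebraType (cylinders X (past j)).
have sF : <<s cylinders X (past j) >> F.
  apply: (@measurable_first_exceed _ TJ) => i ij.
  apply: (@measurableT_comp _ _ _ TJ) => //.
  apply: measurable_funB => //.
  apply: measurableT_comp => //.
  apply: (@measurable_cylinders_sum T R _ X (past j)) => l li.
  by rewrite inE (leq_trans li).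
pose C k := [set z : R * R | t < `| `|z.1 + z.2| - a k|].
have mC k : measurable (C k).
  by apply: measurable_far; apply: measurable_funD; [exact: measurable_fst
    | exact: measurable_snd].
have farE (k : 'I_n) : (j <= k)%N ->
    far k = [set w | C k (partial_sum X j w, increment X j k w)].
  by move=> jk; apply: eq_set => w; rewrite (partial_sumD X w jk).
rewrite (farE k1) // (farE k2) //.
apply: (@indep_lower_bound _ _ _ P F (partial_sum X j) _ _
  [set x | u < `| `|x| - a j|]) => //.
- exact: sub_sigma_cylinders sF.
- exact: measurable_far.
- by move=> B1 B2; exact: indep_increment.
- by move=> B1 B2; exact: indep_increment.
- by move=> w [].
Qed.

(* Both maxima are over nonempty families of nonnegative values, so the
   neutral element 0 does not affect them. *)
Theorem theorem1p1 (d : measure_display) (T : measurableType d) (R : realType)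
    (P : probability T R) (n : nat) (hn : (1 <= n)%N)
    (X : 'I_n -> {RV P >-> R}) (hX : mutually_independent X)
    (a : 'I_n -> R) (t : R) (ht : 0 < t) :
  (P [set w | (11 * t < \big[Num.max/0]_(k < n)
                          `| `|partial_sum X k w| - a k |)%R]
   <= 30%:E * \big[maxe/0]_(k < n)
        P [set w | (t < `| `|partial_sum X k w| - a k |)%R])%E.
Proof.
case: n hn X hX a => // n _ X hX a.
have mS k : measurable_fun setT (partial_sum X k) by exact: measurable_sumRV.
pose Y (k : 'I_n.+1) w := `| `|partial_sum X k w| - a k|.
pose far k := [set w | t < Y k w].
have mfar k : measurable (far k) by exact: measurable_far.
set q := (\big[maxe/0]_(k < _) _)%E.
have Pq k : (P (far k) <= q)%E by exact: le_bigmax.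
have q0 : (0 <= q)%E by exact: bigmax_ge_id.
have q1 : (q <= 1)%E.
  apply/bigmax_leP; split => [|k _]; first exact: lee01.
  exact/probability_le1/mfar.
have qE : q = (fine q)%:E.
  by rewrite fineK // ge0_fin_numE // (le_lt_trans q1) // ltry.
have Pp k : prob P (far k) <= fine q by rewrite -lee_fin probE // -qE.
set F := first_exceed Y (11 * t).
have mF j : measurable (F j).
  apply: measurable_first_exceed => i _; apply: measurableT_comp => //.
  by apply: measurable_funB => //; exact: measurableT_comp.
(* The default 0 of the maximum cannot exceed [11 * t], so exceedance happens at some index. *)
have -> : [set w | 11 * t < \big[Num.max/0]_(k < n.+1) Y k w] =
          \big[setU/set0]_(j < n.+1) F j.
  apply/seteqP; split => w /=.
    move=> /bigmax_gtP[|[j _ hj]]; first by rewrite ltNge mulr_ge0 // ltW.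
    by apply/bigsetU_ordP/first_exceedP; exists j.
  move=> /bigsetU_ordP/first_exceedP[j hj].
  by apply/bigmax_gtP; right; exists j.
(* If [fine q] is at least [1 / 30], the right-hand side is at least 1. *)
rewrite qE; have [q30|q30] := leP (1 / 30) (fine q).
  apply: le_trans (probability_le1 P _) _; first exact: bigsetU_measurable.
  by rewrite -EFinM lee_fin; lra.
have tF : trivIset setT F by exact: trivIset_first_exceed.
rewrite measure_bigsetU_ord //.
rewrite (eq_bigr (fun j => (prob P (F j))%:E)); last first.
  by move=> j _; rewrite probE.
rewrite sumEFin -EFinM lee_fin.
have [m hm] := far_start_dichotomy hX ht q30 Pp.
have bound j : prob P (F j) <=
    15 * (prob P (F j `&` far ord_max) + prob P (F j `&` far m)).
  have le_max : (j <= (ord_max : 'I_n.+1))%N by rewrite -ltnS.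
  have g0 A : 0 <= prob P A by exact: prob_ge0.
  have [jm|mj] := leqP j m.
    have := @first_exceed_bound _ _ _ P _ X hX a t (1 / 15) (11 * t) j ord_max m
      ltac:(lra) le_max jm.
    rewrite -/(far _) -/Y -/F => h; suff : 1 / 15 * prob P (F j) <=
      prob P (F j `&` far ord_max) + prob P (F j `&` far m) by lra.
    apply: h => x /(hm j)[h1|[_ h1]].
      by apply: (le_trans h1); rewrite lerDl.
    by apply: (le_trans h1); rewrite lerDr.
  (* After [m] only the final time is available; using it twice doubles the constant. *)
  suff : 2 / 15 * prob P (F j) <=
      prob P (F j `&` far ord_max) + prob P (F j `&` far ord_max).
    by have := g0 (F j `&` far m); lra.
  apply: (@first_exceed_bound _ _ _ P _ X hX a t (2 / 15) (11 * t) j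
    ord_max ord_max) => //.
  move=> x /(hm j)[h1|[]]; last by rewrite leqNgt mj.
  have -> : 2 / 15 = 1 / 15 + 1 / 15 :> R by lra.
  exact: (lerD h1 h1).
(* The events [F j] are disjoint, so the sums are at most the probabilities of [far ord_max] and
   [far m]; the total is [15 * (p + p)] with [p = fine q]. *)
apply: (le_trans (ler_sum _ (fun j _ => bound j))).
rewrite -mulr_sumr big_split /=.
have h1 := sum_prob_disjoint_le P mF tF (mfar ord_max).
have h2 := sum_prob_disjoint_le P mF tF (mfar m).
have h3 := Pp ord_max; have h4 := Pp m.
lra.
Qed.
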